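(* Let $\Omega>0$, $K>0$, and consider an irrotational perfect fluid with potential $\Phi$, linear equation of state $p=K\epsilon$ and fluid index $f(p)=\exp\int\frac{dp}{\epsilon(p)+p}$ (normalized so that $f(p)=p^{K/(1+K)}$), in the metric $g_{\alpha\beta}=\phi^2\eta_{\alpha\beta}$ with $\phi=e^{\Omega t}(1+\Theta)$. Let $T=g_{\alpha\beta}T^{\alpha\beta}$ be the trace of its energy-momentum tensor. Then $$-\frac16e^{2\Omega t}\,T\,(1+\Theta)^3=-\frac16\Big(3-\frac1K\Big)e^{\frac{(K-1)\Omega}{K}t}\Big[(\partial_t\Phi)^2-|\nabla\Phi|^2\Big]^{\frac{1+K}{2K}}(1+\Theta)^{\frac{2K-1}{K}} .$$
   Context: $\eta_{\alpha\beta}=\mathrm{diag}(-1,1,1,1)$ is the Minkowski metric in coordinates $(t,x^1,x^2,x^3)$, and $\phi>0$ (so $1+\Theta>0$) is a scalar function. The energy-momentum tensor of the perfect fluid is $T^{\alpha\beta}=(\epsilon+p)u^\alpha u^\beta+p\,g^{\alpha\beta}$, with energy density $\epsilon$, pressure $p>0$, and unit timelike velocity $u^\alpha$: $g_{\alpha\beta}u^\alpha u^\beta=-1$. Set $C_\alpha=f\,u_\alpha$ with $u_\alpha=g_{\alpha\beta}u^\beta$, so that $g^{\alpha\beta}C_\alpha C_\beta=-f^2$. The fluid is irrotational with potential $\Phi$ if $C_\alpha=\partial_\alpha\Phi$. Here $\nabla\Phi=(\partial_1\Phi,\partial_2\Phi,\partial_3\Phi)$ and $|\nabla\Phi|^2=\delta^{ab}\partial_a\Phi\,\partial_b\Phi$.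 *)

(* Defs.v *)
From HB Require Import structures.
From mathcomp Require Import all_boot all_order all_algebra.
From mathcomp Require Import all_classical all_reals all_analysis.

Set Implicit Arguments.
Unset Strict Implicit.
Unset Printing Implicit Defensive.

Import Order.TTheory GRing.Theory Num.Theory.
Import numFieldNormedType.Exports.

Local Open Scope classical_set_scope.
Local Open Scope ring_scope.

(* A spacetime point (t, x^1, x^2, x^3) is a row vector of type 'rV[R]_4 whose
   entry of index 0 is t. Tangent vectors and covectors at a point are also
   'rV[R]_4, and twice covariant or contravariant tensors are 'M[R]_4. *)

Definition time (R : realType) (x : 'rV[R]_4) : R := x ord0 ord0.

Definition partial (R : realType) (a : 'I_4) (F : 'rV[R]_4 -> R)
    (x : 'rV[R]_4) : R :=
  'D_(delta_mx ord0 a) F x.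

(* \delta^{ab} \partial_a F \partial_b F over spatial indices. The indices 1, 2,
   3 of 'I_4 are the lift ord0 a for a : 'I_3. The library norm on 'rV[R]_3 is
   the maximum norm, hence the explicit sum. *)
Definition sq_spatial_grad (R : realType) (F : 'rV[R]_4 -> R)
    (x : 'rV[R]_4) : R :=
  \sum_(a < 3) partial (lift ord0 a) F x ^+ 2.

Definition minkowski (R : realType) : 'M[R]_4 :=
  diag_mx (\row_(a < 4) (if a == ord0 then -1 else 1)).

Definition conformal_metric (R : realType) (phi : 'rV[R]_4 -> R)
    (x : 'rV[R]_4) : 'M[R]_4 :=
  phi x ^+ 2 *: minkowski R.

Definition lower (R : realType) (g : 'M[R]_4) (u : 'rV[R]_4) : 'rV[R]_4 :=
  \row_(a < 4) \sum_(b < 4) g a b * u ord0 b.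

Definition unit_timelike (R : realType) (g : 'M[R]_4) (u : 'rV[R]_4) : Prop :=
  \sum_(a < 4) \sum_(b < 4) g a b * u ord0 a * u ord0 b = -1.

(* The inverse metric g^{\alpha\beta} is invmx g. *)
Definition fluid_tensor (R : realType) (g : 'M[R]_4) (eps p : R)
    (u : 'rV[R]_4) : 'M[R]_4 :=
  \matrix_(a < 4, b < 4) ((eps + p) * u ord0 a * u ord0 b + p * invmx g a b).

Definition metric_trace (R : realType) (g T : 'M[R]_4) : R :=
  \sum_(a < 4) \sum_(b < 4) g a b * T a b.

(* f = exp \int dp / (eps(p) + p) on positive pressures; the indefinite integral
   is an arbitrary primitive F, so f is determined up to a constant factor. *)
Definition fluid_index (R : realType) (eps f : R -> R) : Prop :=
  exists F : R -> R, forall q : R, 0 < q ->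
    is_derive q 1 F ((eps q + q)^-1) /\ f q = expR (F q).

Definition potential_of (R : realType) (U : set 'rV[R]_4)
    (C : 'rV[R]_4 -> 'rV[R]_4) (Phi : 'rV[R]_4 -> R) : Prop :=
  forall x : 'rV[R]_4, U x ->
    differentiable Phi x /\ forall a : 'I_4, C x ord0 a = partial a Phi x.

(* Main.v *)
Require Import Defs.
From HB Require Import structures.
From mathcomp Require Import all_boot all_order all_algebra.
From mathcomp Require Import all_classical all_reals all_analysis.
From mathcomp Require Import ring.
Import Order.TTheory GRing.Theory Num.Theory.
Import numFieldNormedType.Exports.
Local Open Scope classical_set_scope.
Local Open Scope ring_scope.

(** The proof evaluates both sides in terms of the pressure and the conformal
    factor.

    Contracting the energy-momentum tensor with the metric in dimension 4 gives
    -(eps + p) + 4 p = 3 p - eps, which is (3 - 1/K) p for the linear equation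
    of state ([metric_trace_fluid_tensor]).

    The Minkowski square of a lowered vector is phi^2 times its square for the
    conformal metric, because lowering scales components by phi^2 up to sign and
    so contributes phi^4 ([lower_conformal_sq]). For C = f u with u unit this
    gives (d_t Phi)^2 - |grad Phi|^2 = (f phi)^2, and since f = p^(K / (1 + K)),
    raising to the power (1 + K) / (2 K) recovers p phi^((1 + K) / K)
    ([fluid_index_powR]). What remains is to collect the exponents of
    exp (Omega t) and of 1 + Theta ([conformal_powR]). *)

(** The trace g_ab g^ab equals the dimension: by symmetry of g^-1 it is the
    matrix trace of g g^-1. *)
Lemma metric_trace_invmx (R : realType) (g : 'M[R]_4) :
  g^T = g -> g \in unitmx -> metric_trace g (invmx g) = 4.
Proof.
move=> g_sym g_unit.
have -> : metric_trace g (invmx g) = \tr (g *m (invmx g)^T).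
  apply: eq_bigr => a _; rewrite mxE.
  by apply: eq_bigr => b _; rewrite mxE.
by rewrite trmx_inv g_sym mulmxV // mxtrace1.
Qed.

Lemma metric_trace_fluid_tensor (R : realType) (g : 'M[R]_4) (eps p : R)
    (u : 'rV[R]_4) :
  g^T = g -> g \in unitmx -> unit_timelike g u ->
  metric_trace g (fluid_tensor g eps p u) = 3 * p - eps.
Proof.
move=> g_sym g_unit u_unit.
have -> : metric_trace g (fluid_tensor g eps p u) =
    (eps + p) * (\sum_(a < 4) \sum_(b < 4) g a b * u ord0 a * u ord0 b)
    + p * metric_trace g (invmx g).
  rewrite /metric_trace !mulr_sumr -big_split; apply: eq_bigr => a _ /=.
  rewrite !mulr_sumr -big_split; apply: eq_bigr => b _ /=.
  by rewrite mxE; ring.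
by rewrite u_unit metric_trace_invmx //; ring.
Qed.

Lemma conformal_metric_sym (R : realType) (phi : 'rV[R]_4 -> R) x :
  (conformal_metric phi x)^T = conformal_metric phi x.
Proof. by rewrite /conformal_metric linearZ /= tr_diag_mx. Qed.

Lemma conformal_metric_unitmx (R : realType) (phi : 'rV[R]_4 -> R) x :
  phi x != 0 -> conformal_metric phi x \in unitmx.
Proof.
move=> phi_neq0; rewrite unitmxE unitfE detZ det_diag mulf_neq0 //.
  by rewrite !expf_neq0.
apply/prodf_neq0 => a _; rewrite mxE.
by case: ifP; rewrite ?oppr_eq0 oner_eq0.
Qed.

(** A negated component in [minkowski] squares to the same value, so lowering
    multiplies every squared component by phi^4, whereas the conformal metric
    only supplies a factor phi^2. *)
Lemma lower_conformal_sq (R : realType) (phi : 'rV[R]_4 -> R) x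
    (u : 'rV[R]_4) :
  let g := conformal_metric phi x in
  lower g u ord0 ord0 ^+ 2
    - \sum_(a < 3) lower g u ord0 (lift ord0 a) ^+ 2 =
  - phi x ^+ 2 * \sum_(a < 4) \sum_(b < 4) g a b * u ord0 a * u ord0 b.
Proof.
move=> g.
pose s (a : 'I_4) : R := if a == ord0 then -1 else 1.
have gE a b : g a b = if a == b then phi x ^+ 2 * s a else 0.
  by rewrite !mxE -/(s a) mulrb [LHS]fun_if mulr0.
have lowerE a : lower g u ord0 a = phi x ^+ 2 * s a * u ord0 a.
  rewrite mxE (bigD1 a) //= gE eqxx big1 ?addr0 // => b /negPf ba.
  by rewrite gE eq_sym ba mul0r.
have -> : \sum_(a < 4) \sum_(b < 4) g a b * u ord0 a * u ord0 b =
    \sum_(a < 4) phi x ^+ 2 * s a * u ord0 a ^+ 2.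
  apply: eq_bigr => a _.
  rewrite (bigD1 a) //= gE eqxx big1 ?addr0 => [|b /negPf ba]; first by ring.
  by rewrite gE eq_sym ba !mul0r.
rewrite [in RHS]big_ord_recl mulrDr mulr_sumr -sumrN; congr (_ + _).
  by rewrite lowerE /s eqxx; ring.
by apply: eq_bigr => a _; rewrite lowerE /s /=; ring.
Qed.

(** The exponent (1 + K) / (2 K) undoes both the square and the power
    K / (1 + K) that defines the fluid index. *)
Lemma fluid_index_powR (R : realType) (K p phi : R) :
  0 < K -> 0 < p -> 0 < phi ->
  ((p `^ (K / (1 + K)) * phi) ^+ 2) `^ ((1 + K) / (2 * K)) =
  p * phi `^ ((1 + K) / K).
Proof.
move=> K_gt0 p_gt0 phi_gt0.
have K_neq0 : K != 0 by rewrite gt_eqF.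
have K1_neq0 : 1 + K != 0 by rewrite gt_eqF // addr_gt0.
rewrite -powR_mulrn ?mulr_ge0 ?powR_ge0 ?ltW // -powRrM.
have -> : 2 * ((1 + K) / (2 * K)) = (1 + K) / K by field.
rewrite powRM ?powR_ge0 ?ltW // -powRrM.
have -> : K / (1 + K) * ((1 + K) / K) = 1 by field; rewrite K_neq0 K1_neq0.
by rewrite powRr1 // ltW.
Qed.

Lemma conformal_powR (R : realType) (Omega K t a : R) :
  0 < K -> 0 < a ->
  expR ((K - 1) * Omega / K * t) * (expR (Omega * t) * a) `^ ((1 + K) / K)
    * a `^ ((2 * K - 1) / K) = expR (2 * Omega * t) * a ^+ 3.
Proof.
move=> K_gt0 a_gt0; have K_neq0 : K != 0 by rewrite gt_eqF.
rewrite powRM ?expR_ge0 ?ltW // -expRM mulrA -expRD -mulrA -powRD; last first.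
  by rewrite (gt_eqF a_gt0) implybT.
rewrite -powR_mulrn ?ltW //; congr (expR _ * _ `^ _); by field.
Qed.

Theorem mainTheorem3 (R : realType) (Omega K : R)
  (U : set 'rV[R]_4)
  (Theta phi Phi p : 'rV[R]_4 -> R) (u : 'rV[R]_4 -> 'rV[R]_4)
  (eps f : R -> R)
  (Omega_gt0 : 0 < Omega) (K_gt0 : 0 < K)
  (U_open : open U)
  (phiE : forall x : 'rV[R]_4, U x ->
     phi x = expR (Omega * time x) * (1 + Theta x))
  (phi_gt0 : forall x : 'rV[R]_4, U x -> 0 < phi x)
  (p_gt0 : forall x : 'rV[R]_4, U x -> 0 < p x)
  (eos : forall q : R, 0 < q -> q = K * eps q)
  (f_index : fluid_index eps f)
  (f_normalized : forall q : R, 0 < q -> f q = q `^ (K / (1 + K)))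
  (u_unit : forall x : 'rV[R]_4, U x ->
     unit_timelike (conformal_metric phi x) (u x))
  (irrotational : potential_of U
     (fun x : 'rV[R]_4 => f (p x) *: lower (conformal_metric phi x) (u x)) Phi) :
  forall x : 'rV[R]_4, U x ->
    let T := metric_trace (conformal_metric phi x)
               (fluid_tensor (conformal_metric phi x) (eps (p x)) (p x) (u x)) in
    - (1 / 6) * expR (2 * Omega * time x) * T * (1 + Theta x) ^+ 3 =
    - (1 / 6) * (3 - 1 / K) * expR ((K - 1) * Omega / K * time x)
      * (partial ord0 Phi x ^+ 2 - sq_spatial_grad Phi x) `^ ((1 + K) / (2 * K))
      * (1 + Theta x) `^ ((2 * K - 1) / K).
Proof.
move=> x Ux T.
set g := conformal_metric phi x in T *.
have phix_gt0 := phi_gt0 x Ux; have px_gt0 := p_gt0 x Ux.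
have K_neq0 : K != 0 by rewrite gt_eqF.
have Theta_gt0 : 0 < 1 + Theta x.
  by move: phix_gt0; rewrite phiE // pmulr_rgt0 ?expR_gt0.
have epsE : eps (p x) = p x / K.
  by rewrite {2}(eos (p x) px_gt0) mulrC mulKf.
have TE : T = (3 - 1 / K) * p x.
  rewrite /T metric_trace_fluid_tensor ?conformal_metric_sym //; last first.
  - exact: u_unit.
  - by rewrite conformal_metric_unitmx ?gt_eqF.
  by rewrite epsE; field.
have gradE : partial ord0 Phi x ^+ 2 - sq_spatial_grad Phi x =
    (f (p x) * phi x) ^+ 2.
  have [_ dPhi] := irrotational x Ux.
  have dPhi_sq a : partial a Phi x ^+ 2 =
      f (p x) ^+ 2 * lower g (u x) ord0 a ^+ 2.
    by rewrite -dPhi mxE exprMn.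
  rewrite /sq_spatial_grad dPhi_sq (eq_bigr _ (fun a _ => dPhi_sq _)).
  by rewrite -mulr_sumr -mulrBr lower_conformal_sq u_unit //; ring.
rewrite gradE f_normalized // fluid_index_powR // TE.
transitivity (- (1 / 6) * (3 - 1 / K) * p x *
    (expR (2 * Omega * time x) * (1 + Theta x) ^+ 3)); first by ring.
by rewrite -(conformal_powR _ _ K) // -phiE //; ring.
Qed.
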